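(* Let $k$ be an algebraically closed field and let $A_n$ denote the quiver $1\to2\to\cdots\to n$. There exists a filtration $F$ on $K_0(\mathbf{Rep}_k A_n)$ such that every complete exceptional sequence $(E_1,\ldots,E_n)$ of representations of $A_n$ (up to isomorphism of its members) is uniquely determined by the sequence of filtration levels of $E_1,\ldots,E_n$, and such sequences are in one-to-one correspondence with the parking functions on $n$ elements.
   Context: Representations are finite-dimensional over $k$; $\mathbf{Rep}_kA_n$ is the abelian (hereditary) category of representations. An indecomposable representation $E$ is exceptional if $\mathrm{Ext}^1(E,E)=0$. A sequence $(E_1,\ldots,E_r)$ of exceptional representations is an exceptional sequence if $\mathrm{Hom}(E_j,E_i)=0=\mathrm{Ext}^1(E_j,E_i)$ for all $j>i$; it is complete if $r=n$. A filtration here is a decreasing chain of subgroups $K_0(\mathbf{Rep}_kA_n)=F_1\supseteq F_2\supseteq\cdots\supseteq F_n$, and the filtration level of $E$ is the largest $m$ with $[E]\in F_m$. A parking function on $n$ elements is a function $f:\{1,\ldots,n\}\to\{1,\ldots,n\}$ with $|f^{-1}(\{1,\ldots,m\})|\ge m$ for all $m$. *)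

(* Defs.v *)
From HB Require Import structures.
From mathcomp Require Import all_boot all_order all_algebra.
From mathcomp Require Import boolp freeg ring_quotient.

Set Implicit Arguments.
Unset Strict Implicit.
Unset Printing Implicit Defensive.

Import GRing.Theory.
Local Open Scope ring_scope.

Record quiver := Quiver {
  vertex : finType;
  arrow : finType;
  src : arrow -> vertex;
  tgt : arrow -> vertex }.

Lemma linear_quiver_tgt_subproof n (a : 'I_n.-1) : (a.+1 < n)%N.
Proof. by case: n a => [[]|n a] //=; rewrite ltnS ltn_ord. Qed.

(* Vertex i : 'I_n is the vertex i+1 of 1 -> 2 -> ... -> n. *)
Definition linear_quiver (n : nat) : quiver :=
  @Quiver 'I_n 'I_n.-1
    (fun a => widen_ord (leq_pred n) a)
    (fun a => Ordinal (linear_quiver_tgt_subproof a)).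

(* As in mathcomp's mxrepresentation, finite-dimensional spaces are coordinate
   spaces 'rV[k]_d and linear maps are matrices acting on row vectors (v *m A).
   This keeps the type of representations small enough
   to be a choiceType, which the free abelian group below requires; a record
   containing vectTypes raises a universe inconsistency there. *)
Record rep (k : fieldType) (Q : quiver) := Rep {
  dimv : vertex Q -> nat;
  repmx : forall a : arrow Q, 'M[k]_(dimv (src a), dimv (tgt a)) }.

HB.instance Definition _ (k : fieldType) (Q : quiver) :=
  gen_eqMixin (rep k Q).
HB.instance Definition _ (k : fieldType) (Q : quiver) :=
  gen_choiceMixin (rep k Q).

Section Representations.
Variables (k : fieldType) (Q : quiver).
Implicit Types U V W X : rep k Q.

Definition family V W := forall i : vertex Q, 'M[k]_(dimv V i, dimv W i).

Definition is_hom V W (f : family V W) : Prop :=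
  forall a : arrow Q, repmx V a *m f (tgt a) = f (src a) *m repmx W a.

Definition isomorphic V W : Prop :=
  exists (f : family V W) (g : family W V),
    [/\ is_hom f, is_hom g,
        forall i, f i *m g i = 1%:M
      & forall i, g i *m f i = 1%:M].

Definition is_zero V : Prop := forall i, dimv V i = 0%N.

Definition dsum V W : rep k Q :=
  Rep (dimv := fun i => (dimv V i + dimv W i)%N)
      (fun a => block_mx (repmx V a) 0 0 (repmx W a)).

Definition indecomposable V : Prop :=
  ~ is_zero V /\
  forall V1 V2, isomorphic V (dsum V1 V2) -> is_zero V1 \/ is_zero V2.

(* 0 -> W -> X -> V -> 0 *)
Definition short_exact W X V (f : family W X) (g : family X V) : Prop :=
  [/\ is_hom f, is_hom g,
      forall i, row_free (f i),
      forall i, row_full (g i)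
    & forall i, (f i == kermx (g i))%MS].

Definition hom_zero V W : Prop :=
  forall f : family V W, is_hom f -> forall i, f i = 0.

(* Ext^1(V, W) is taken in Yoneda's sense: the classes of extensions
   0 -> W -> X -> V -> 0, with the class of the split extension as zero. *)
Record extension V W := Extension {
  ext_mid : rep k Q;
  ext_inc : family W ext_mid;
  ext_prj : family ext_mid V;
  ext_exact : short_exact ext_inc ext_prj }.

Definition ext_equiv V W (e e' : extension V W) : Prop :=
  exists h : family (ext_mid e) (ext_mid e'),
    [/\ is_hom h,
        forall i, ext_inc e i *m h i = ext_inc e' i
      & forall i, h i *m ext_prj e' i = ext_prj e i].

Definition split_inc V W : family W (dsum W V) := fun i => row_mx 1%:M 0.
Definition split_prj V W : family (dsum W V) V := fun i => col_mx 0 1%:M.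

Lemma split_exact V W : short_exact (@split_inc V W) (@split_prj V W).
Proof.
split.
- move=> a; rewrite /split_inc /dsum /= mul_mx_row mulmx1 mulmx0.
  by rewrite mul_row_block !mul1mx !mul0mx !addr0.
- move=> a; rewrite /split_prj /dsum /= [RHS]mul_col_mx mul0mx mul1mx.
  by rewrite mul_block_col !mulmx0 !mulmx1 !add0r.
- move=> i; apply/row_freeP; exists (col_mx 1%:M 0).
  by rewrite /split_inc mul_row_col mulmx1 mulmx0 addr0.
- move=> i; apply/row_fullP; exists (row_mx 0 1%:M).
  by rewrite /split_prj mul_row_col mulmx0 mulmx1 add0r.
- move=> i; apply/andP; split.
    by apply/sub_kermxP; rewrite mul_row_col mulmx0 mul0mx addr0.
  set K := kermx _; have /sub_kermxP : (K <= kermx (@split_prj V W i))%MS by [].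
  rewrite -[K]hsubmxK mul_row_col mulmx0 mulmx1 add0r => ->.
  by apply/submxP; exists (lsubmx K); rewrite mul_mx_row mulmx1 mulmx0.
Qed.

Definition split_extension V W : extension V W :=
  Extension (@split_exact V W).

Definition ext1_zero V W : Prop :=
  forall e : extension V W, ext_equiv e (split_extension V W).

Definition exceptional V : Prop := indecomposable V /\ ext1_zero V V.

Definition exceptional_sequence r (E : 'I_r -> rep k Q) : Prop :=
  (forall i, exceptional (E i)) /\
  (forall i j : 'I_r, (i < j)%N ->
     hom_zero (E j) (E i) /\ ext1_zero (E j) (E i)).

(* The subgroup of the free abelian group on representations generated by the
   X - W - V for all short exact sequences 0 -> W -> X -> V -> 0. It makes
   isomorphic representations equal in the quotient, the zero representation
   having class 0. *)
Definition K0_relations : pred {freeg (rep k Q) / int} := fun x =>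
  `[< forall S : zmodClosed {freeg (rep k Q) / int},
        (forall W X V (f : family W X) (g : family X V), short_exact f g ->
           [freeg [:: (1, X)]] - [freeg [:: (1, W)]] - [freeg [:: (1, V)]]
             \in S) ->
        x \in S >].

Lemma K0_relations_zmod_closed : zmod_closed K0_relations.
Proof.
split; first by apply/asboolP => S _; exact: rpred0.
move=> x y /asboolP Sx /asboolP Sy; apply/asboolP => S HS.
by apply: rpredB; [exact: Sx | exact: Sy].
Qed.

Definition K0_subgroup : zmodClosed {freeg (rep k Q) / int} :=
  HB.pack K0_relations
    (GRing.isZmodClosed.Build _ K0_relations K0_relations_zmod_closed).

Definition K0 : zmodType := Quotient.quot K0_subgroup.

Definition K0_class V : K0 := \pi_(Quotient.quot K0_subgroup)%qT [freeg [:: (1, V)]].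

End Representations.

Section Filtrations.
Variable n : nat.

(* G = F 1 >= F 2 >= ... >= F n; the other values of F are irrelevant. *)
Definition filtration (G : zmodType) (F : nat -> zmodClosed G) : Prop :=
  (forall x, x \in F 1%N) /\
  (forall m, (1 <= m < n)%N -> {subset F m.+1 <= F m}).

Definition filtration_level (G : zmodType) (F : nat -> zmodClosed G) (x : G) :
    nat :=
  (\max_(1 <= m < n.+1 | x \in F m) m)%N.

Definition levels (k : fieldType) (Q : quiver) (F : nat -> zmodClosed (K0 k Q))
    (E : 'I_n -> rep k Q) : {ffun 'I_n -> nat} :=
  [ffun i => filtration_level F (K0_class (E i))].

(* Element i : 'I_n of the source is i+1, while values are not shifted. *)
Definition parking_function (f : {ffun 'I_n -> nat}) : Prop :=
  (forall i, (1 <= f i <= n)%N) /\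
  (forall m, (1 <= m <= n)%N -> (m <= #|[set i | 1 <= f i <= m]|)%N).

End Filtrations.

(* Main.v *)
Require Import Defs.
From HB Require Import structures.
From mathcomp Require Import all_boot all_order all_algebra.
From mathcomp Require Import boolp freeg ring_quotient.
From mathcomp Require Import zify.
Import Defs.

(** Cutting [1 -> 2 -> ... -> n] at half-open intervals [a, b) of the vertices
numbered from 0, the indecomposable representations are the interval
representations M[a, b) ([indecomposable_interval]); Hom and Ext between two of
them have dimension at most one and are decided by the relative position of the
end points ([interval_hom_zero], [interval_ext1_zero]).  The filtration is by
support: F m consists of the classes whose dimension vector vanishes at the
first m - 1 vertices, so that M[a, b) has level a + 1.  A complete exceptional
sequence thus becomes a family of n intervals [a j, b j) in [0, n) subject to a
pairwise compatibility condition, and the claim is that the starting points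
a 0, ..., a (n - 1) are an arbitrary parking function and determine the end
points.

Everything in one direction rests on a dimension count
([exceptional_intervals_card]): the Euler form is unitriangular on an
exceptional family, so its dimension vectors are linearly independent.  The
vectors supported on the vertices >= m span a space of dimension n - m; there
are thus at most n - m indices with a i >= m, which is the parking condition
([complete_parking]).

For the end points, order the indices lexicographically by (a i, i), and let
c (x, t) be the number of indices before (x, t).  The indices from (a j, j) up
to (b j, j) are those of the intervals contained in [a j, b j), whereas all the
other intervals are constant along [a j, b j).  Counting dimensions on both
sides gives c (b j, j) - c (a j, j) = b j - a j ([complete_end]).  At an
intermediate x, a similar count, in a family where [a j, b j) has been replaced
by [x, b j), gives c (x, j) - c (a j, j) > x - a j ([complete_before_end]).
Hence b j is the first x > a j at which the walk x |-> c (x, j) - x is back to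
its value at a j or below, a description in terms of a alone
([complete_intervals_inj]).  Conversely, for a parking function this first
return exists, since c (n, j) = n, and comparing the walks of two indices shows
that the intervals so obtained are compatible ([parking_complete]). *)

Set Implicit Arguments.
Unset Strict Implicit.
Unset Printing Implicit Defensive.

Import GRing.Theory.
Local Open Scope ring_scope.

(** * Hom and Ext patterns of half-open intervals *)

Section Intervals.
Local Open Scope nat_scope.

Definition inside (a b v : nat) : bool := a <= v < b.

(** The condition under which M[a, b) maps nontrivially to M[c, d): the interval
[a, d) supports a quotient of the former and a subrepresentation of the latter. *)
Definition hom_overlap (a b c d : nat) : bool := (c <= a < d) && (d <= b).

(** The condition for a nonsplit extension of M[a, b) by M[c, d), whose middle
term is M[a, d) + M[c, b), the second summand being zero if c = b. *)
Definition ext_overlap (a b c d : nat) : bool := (a < c <= b) && (b < d).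

Definition exceptional_intervals n (a b : 'I_n -> nat) (S : {set 'I_n}) : Prop :=
  {in S, forall i, a i < b i} /\
  {in S &, forall i j : 'I_n, i < j ->
     ~~ hom_overlap (a j) (b j) (a i) (b i) /\
     ~~ ext_overlap (a j) (b j) (a i) (b i)}.

(** Both sides are the Euler form of the two intervals.  The left one is linear
in the indicator function of [c, d), which is what the independence argument
below exploits. *)
Lemma euler_interval a b c d : a < b -> c < d ->
  ((inside c d a)%:Z - (inside c d b)%:Z
    = (hom_overlap a b c d)%:Z - (ext_overlap a b c d)%:Z)%R.
Proof. rewrite /inside /hom_overlap /ext_overlap; lia. Qed.

(** The second hypothesis says that the positions in [D] see everything about the
intervals of [S].  A linear relation between the indicator functions of the
intervals of [S] on [D] then holds at all positions.  Evaluate it at [a j] minus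
at [b j], with [j] the largest index with a nonzero coefficient: by
[euler_interval] this Euler form vanishes against all smaller indices, and it is
1 against [j] itself, a contradiction. *)
Lemma exceptional_intervals_card n (a b : 'I_n -> nat) (S D : {set 'I_n}) :
  exceptional_intervals a b S ->
  (forall v, {in S, forall i, ~~ inside (a i) (b i) v} \/
     exists2 w : 'I_n, w \in D &
       {in S, forall i, inside (a i) (b i) v = inside (a i) (b i) w}) ->
  #|S| <= #|D|.
Proof.
move=> [ab ex] cover; rewrite leqNgt; apply/negP => ltDS.
pose X : 'M[rat]_(#|S|, #|D|) := \matrix_(s, t)
  (inside (a (enum_val s)) (b (enum_val s)) (enum_val t : 'I_n))%:R%R.
have [u uX u0] : exists2 u : 'rV[rat]_#|S|, (u *m X = 0)%R & (u != 0)%R.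
  have : kermx X != 0%R.
    by rewrite kermx_eq0 /row_free neq_ltn (leq_ltn_trans (rank_leq_col X)).
  by case/rowV0Pn => u /sub_kermxP uX u0; exists u.
have comb0 v : (\sum_s u ord0 s *
    (inside (a (enum_val s)) (b (enum_val s)) v)%:R = 0)%R.
  case: (cover v) => [out|[w wD same]].
    by apply: big1 => s _; rewrite (negbTE (out _ (enum_valP s))) mulr0.
  have := congr1 (fun A : 'rV_#|D| => A ord0 (enum_rank_in wD w)) uX.
  rewrite !mxE => e; rewrite -[RHS]e; apply: eq_bigr => s _.
  by rewrite mxE enum_rankK_in // (same _ (enum_valP s)).
have [s0 us0] : exists s, u ord0 s != 0%R.
  by case/rV0Pn: u0 => s; exists s.
case: (arg_maxnP (fun s => nat_of_ord (enum_val s)) (P := fun s => u ord0 s != 0%R) us0).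
move=> s us smax.
set j := enum_val s; have jS : j \in S := enum_valP s.
have : (\sum_t u ord0 t * ((inside (a (enum_val t)) (b (enum_val t)) (a j))%:R -
     (inside (a (enum_val t)) (b (enum_val t)) (b j))%:R) = 0)%R.
  under eq_bigr do rewrite mulrBr.
  by rewrite sumrB !comb0 subr0.
rewrite (bigD1 s) //= big1 ?addr0; last first.
  move=> t nts; case: (ltngtP (enum_val t) j) => [lt_tj|gt_tj|/val_inj/enum_val_inj ets].
  - have tS : enum_val t \in S := enum_valP t.
    have [/negbTE nh /negbTE ne] := ex _ _ tS jS lt_tj.
    have := euler_interval (ab _ jS) (ab _ tS); rewrite nh ne subrr => /eqP.
    rewrite subr_eq0 => /eqP[->]; by rewrite subrr mulr0.
  - have : u ord0 t == 0%R.
      by apply: contraLR gt_tj => /smax; rewrite -leqNgt.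
    by move/eqP->; rewrite mul0r.
  - by rewrite ets eqxx in nts.
have := ab _ jS; rewrite -/j /inside leqnn ltnn andbF => ->; rewrite subr0 mulr1.
by move=> u0'; rewrite u0' eqxx in us.
Qed.

Lemma card_inside n x y : y <= n -> #|[set v : 'I_n | inside x y v]| = y - x.
Proof.
elim: y => [|y IH] yn.
  by rewrite sub0n; apply: eq_card0 => v; rewrite inE /inside ltn0 andbF.
have [lt_xy|le_yx] := ltnP y x.
  rewrite (eqP (lt_xy : y.+1 - x == 0)); apply: eq_card0 => v.
  rewrite !inE /inside; lia.
rewrite subSn // -(IH (ltnW yn)) (cardsD1 (Ordinal yn)) inE /inside /= le_yx leqnn.
by rewrite add1n; congr _.+1; apply: eq_card => v; rewrite !inE /inside -val_eqE /=; lia.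
Qed.

Definition complete_intervals n (a b : 'I_n -> nat) : Prop :=
  exceptional_intervals a b setT /\ forall i, b i <= n.

Lemma exceptional_intervalsS n (a b : 'I_n -> nat) (S S' : {set 'I_n}) :
  S \subset S' -> exceptional_intervals a b S' -> exceptional_intervals a b S.
Proof.
move=> /subsetP sub [ab ex]; split=> [i /sub|i j /sub iS /sub jS]; first exact: ab.
exact: ex.
Qed.

Lemma complete_parking n (a b : 'I_n -> nat) m :
  complete_intervals a b -> m <= n -> m <= #|[set i | a i < m]|.
Proof.
move=> [ex bn] mn.
have : #|~: [set i | a i < m]| <= #|[set v : 'I_n | inside m n v]|.
  apply: exceptional_intervals_card (exceptional_intervalsS (subsetT _) ex) _.
  move=> v; have [/andP[mv vn]|nv] := boolP (inside m n v).
    by right; exists (Ordinal vn) => //; rewrite inE /inside mv.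
  left=> i; rewrite !inE -leqNgt => am; apply: contra nv.
  by move=> /andP[av vb]; rewrite /inside (leq_trans am av) (leq_trans vb).
rewrite card_inside // cardsCs setCK card_ord; lia.
Qed.

Lemma complete_pair n (a b : 'I_n -> nat) (i j : 'I_n) :
  complete_intervals a b -> i < j ->
  ~~ hom_overlap (a j) (b j) (a i) (b i) /\ ~~ ext_overlap (a j) (b j) (a i) (b i).
Proof. by move=> [[_ ex] _]; apply: ex; rewrite inE. Qed.

(** * The starting points determine the end points *)

(** The end point of the interval of [j] is the place of the first return of the
walk x |-> #|lex_before a x j| - x to its value at [a j]. *)
Definition lex_before n (a : 'I_n -> nat) (x t : nat) : {set 'I_n} :=
  [set i : 'I_n | (a i < x) || (a i == x) && (i < t)].

(** The intervals inside [a j, b j) are recognised from starting points alone;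
compatibility also forces all the others to be disjoint from it or to contain
it, hence to be constant along it. *)
Lemma complete_lex_before n (a b : 'I_n -> nat) (i j : 'I_n) :
  complete_intervals a b ->
  if i \in lex_before a (b j) j :\: lex_before a (a j) j
  then a j <= a i /\ b i <= b j
  else i = j \/ b i <= a j \/ b j <= a i \/ a i <= a j /\ b j <= b i.
Proof.
move=> cab; have [[ab _] bn] := cab.
have := ab i (in_setT _); have := ab j (in_setT _).
have := @complete_pair _ _ _ i j cab; have := @complete_pair _ _ _ j i cab.
rewrite !inE /hom_overlap /ext_overlap.
case: (ltngtP i j) => [ij|ij|/val_inj ->].
- move=> _ /(_ isT) []; case: ifP; lia.
- move=> /(_ isT) [] ? ? _; case: ifP; lia.
- case: ifP => //; lia.
Qed.

Lemma card_lex_before_diff n (a : 'I_n -> nat) x y t : x <= y ->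
  #|lex_before a y t| = #|lex_before a x t| + #|lex_before a y t :\: lex_before a x t|.
Proof.
move=> xy; rewrite -(cardsID (lex_before a x t) (lex_before a y t)); congr (_ + _).
apply: eq_card => i; rewrite !inE; lia.
Qed.

(** The inner intervals are supported on [b j - a j] positions, which gives one
inequality.  The outer ones, to which the interval of [j] itself may be added,
are determined by the [n - (b j - a j) + 1] positions left when [a j, b j) is
shrunk to a point, which gives the other. *)
Lemma complete_end n (a b : 'I_n -> nat) (j : 'I_n) :
  complete_intervals a b ->
  #|lex_before a (b j) j| = #|lex_before a (a j) j| + (b j - a j).
Proof.
move=> cab; have [ex bn] := cab; have [ab _] := ex.
have abj := ab j (in_setT _).
rewrite (card_lex_before_diff _ _ (ltnW abj)); congr (_ + _).
set T := _ :\: _; apply/eqP; rewrite eqn_leq; apply/andP; split.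
  rewrite -(card_inside _ (bn j)).
  apply: exceptional_intervals_card (exceptional_intervalsS (subsetT _) ex) _.
  move=> v; have [vj|nv] := boolP (inside (a j) (b j) v).
    have vn : v < n by case/andP: vj => _ /leq_trans; apply.
    by right; exists (Ordinal vn); rewrite ?inE.
  left=> i iT; have := complete_lex_before i j cab; rewrite -/T iT.
  by move: nv; rewrite /inside; lia.
have jT : j \in T by rewrite !inE ltnn eqxx ltnn abj.
(* The position a j represents all the positions of its interval. *)
have : #|j |: ~: T| <= #|~: [set v : 'I_n | inside (a j).+1 (b j) v]|.
  apply: exceptional_intervals_card (exceptional_intervalsS (subsetT _) ex) _.
  move=> v; have [vn|nv] := ltnP v n; last first.
    by left=> i _; have := bn i; rewrite /inside; lia.
  right; have [vj|nvj] := boolP (inside (a j).+1 (b j) v); last first.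
    by exists (Ordinal vn) => //; rewrite !inE.
  exists (Ordinal (leq_trans abj (bn j))).
    by rewrite !inE /inside /= ltnn.
  move=> i /=; rewrite in_setU1 in_setC => /orP iT.
  have := complete_lex_before i j cab; rewrite -/T.
  case: iT => [/eqP->|/negbTE->].
    by rewrite jT => _; move: vj; rewrite /inside; lia.
  move: vj; rewrite /inside => vj []; first by move=> ->; lia.
  by have := ab i (in_setT _); lia.
rewrite cardsU1 in_setC jT [#|~: [set v : 'I_n | _]|]cardsCs setCK card_inside //.
rewrite [#|~: T|]cardsCs setCK card_ord.
have : #|T| <= n by have := max_card (mem T); rewrite card_ord.
have := bn j; rewrite /=; lia.
Qed.

(** The intervals inside [a j, b j) with (a i, i) not before (x, j) lie in
[x, b j), and they stay exceptional when the interval [x, b j) is added in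
position [j]: hence there are less than [b j - x] of them. *)
Lemma complete_before_end n (a b : 'I_n -> nat) (j : 'I_n) x :
  complete_intervals a b -> a j < x < b j ->
  #|lex_before a (a j) j| + (x - a j) < #|lex_before a x j|.
Proof.
move=> cab /andP[ax xb]; have [ex bn] := cab; have [ab _] := ex.
have := complete_end j cab; rewrite (card_lex_before_diff _ _ (ltnW xb)).
set T := _ :\: _.
have jT : j \notin T by rewrite !inE ltnn andbF orbF -leqNgt ltnNge; lia.
suff : #|j |: T| <= b j - x.
  by rewrite cardsU1 jT; move: #|T| #|lex_before a x j| => p r /=; lia.
rewrite -(card_inside _ (bn j)).
have T_in i : i \in T -> [/\ x <= a i, b i <= b j & (i == j = false)].
  move=> iT; have := complete_lex_before i j cab.
  have : i \in lex_before a (b j) j :\: lex_before a (a j) j.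
    by move: iT; rewrite !inE; lia.
  move=> -> [_ bi]; split=> //; last by apply: contraNF jT => /eqP <-.
  by move: iT; rewrite !inE; lia.
apply: (@exceptional_intervals_card _ (fun i => if i == j then x else a i) b).
  split=> [i|i1 i2 /setU1P[->|i1T] /setU1P[->|i2T] lt12].
  - by case: eqP => [->|_ _] //; apply: ab.
  - by rewrite ltnn in lt12.
  - have [x2 b2 ne2] := T_in _ i2T; rewrite eqxx ne2.
    have := complete_pair cab lt12; have := ab i2 (in_setT _).
    move: i2T; rewrite !inE /hom_overlap /ext_overlap; lia.
  - have [x1 b1 ne1] := T_in _ i1T; rewrite eqxx ne1.
    have := complete_pair cab lt12; have := ab i1 (in_setT _).
    move: i1T; rewrite !inE /hom_overlap /ext_overlap; lia.
  - have [_ _ ->] := T_in _ i1T; have [_ _ ->] := T_in _ i2T.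
    exact: complete_pair.
move=> v; have [vj|nv] := boolP (inside x (b j) v).
  have vn : v < n by case/andP: vj => _ /leq_trans; apply.
  by right; exists (Ordinal vn); rewrite ?inE.
left=> i /setU1P[->|iT]; first by rewrite eqxx.
by have [] := T_in _ iT => ? ? ->; move: nv; rewrite /inside; lia.
Qed.

Lemma complete_intervals_inj n (a b b' : 'I_n -> nat) :
  complete_intervals a b -> complete_intervals a b' -> b =1 b'.
Proof.
have le (c c' : 'I_n -> nat) j :
    complete_intervals a c -> complete_intervals a c' -> c' j <= c j.
  move=> ac ac'; rewrite leqNgt; apply/negP => lt.
  have [[ab _] _] := ac; have abj := ab j (in_setT _).
  have := complete_before_end ac' (x := c j) (j := j).
  by rewrite abj lt (complete_end j ac) ltnn => /(_ isT).
by move=> cb cb' j; apply/eqP; rewrite eqn_leq !le.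
Qed.

(** * Every parking function is realised *)

Lemma card_lex_before_le n (a : 'I_n -> nat) x t y u : (x < y) || (x == y) && (t <= u) ->
  #|lex_before a x t| <= #|lex_before a y u|.
Proof. move=> le; apply/subset_leq_card/subsetP => i; rewrite !inE; lia. Qed.

Lemma card_lex_before_lt n (a : 'I_n -> nat) x t y u (i : 'I_n) :
  (x < y) || (x == y) && (t <= u) ->
  i \notin lex_before a x t -> i \in lex_before a y u ->
  #|lex_before a x t| < #|lex_before a y u|.
Proof.
move=> le ix iy; apply/proper_card/properP; split; last by exists i.
by apply/subsetP => k; rewrite !inE; lia.
Qed.

Lemma card_lex_before_lt2 n (a : 'I_n -> nat) x t y u (i j : 'I_n) :
  (x < y) || (x == y) && (t <= u) -> i != j ->
  i \notin lex_before a x t -> i \in lex_before a y u ->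
  j \notin lex_before a x t -> j \in lex_before a y u ->
  #|lex_before a x t|.+1 < #|lex_before a y u|.
Proof.
move=> le ij ix iy jx jy.
have : j |: lex_before a x t \proper lex_before a y u.
  apply/properP; split; last by exists i; rewrite // !inE negb_or ij; move: ix; rewrite !inE.
  by apply/subsetP => k /setU1P[->//|]; rewrite !inE; lia.
by move/proper_card; rewrite cardsU1 jx.
Qed.

(** With h (x, t) = #|lex_before a x t| - x, the end point [b j] is the first
x > a j with h (x, j) <= h (a j, j).  Two facts decide every case below: for a
fixed x, h (x, t) is nondecreasing in t; and a walk loses at most 1 from one x to
the next, even when it passes from an index [j] to another index [i], that is,
h (x - 1, j) <= h (x, i) + 1.  The neighbouring case where x - 1 is a starting
point needs the sharper count that the indices starting there contribute. *)
Lemma parking_complete n (a : 'I_n -> nat) :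
  (forall i, a i < n) -> (forall m, m <= n -> m <= #|[set i | a i < m]|) ->
  exists b, complete_intervals a b.
Proof.
move=> an park.
pose closes j x := (a j < x) && (#|lex_before a x j| <= #|lex_before a (a j) j| + (x - a j)).
have closes_n j : closes j n.
  rewrite /closes an /= (leq_trans (max_card _)) // card_ord.
  have := park (a j) (ltnW (an j)).
  have : #|[set i | a i < a j]| <= #|lex_before a (a j) j|.
    by apply/subset_leq_card/subsetP => i; rewrite !inE => ->.
  by have := an j; move: #|lex_before a (a j) j| #|[set i | a i < a j]| => p q; lia.
pose b j := ex_minn (ex_intro (closes j) n (closes_n j)).
have bP j : [/\ a j < b j, b j <= n,
    #|lex_before a (b j) j| <= #|lex_before a (a j) j| + (b j - a j)
  & forall x, a j < x < b j -> #|lex_before a (a j) j| + (x - a j) < #|lex_before a x j|].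
  rewrite /b; case: ex_minnP => m /andP[lt le] min; split=> //; first exact: min.
  move=> x /andP[ax xm]; rewrite ltnNge; apply/negP => lex.
  by have := min x; rewrite /closes ax lex leqNgt xm => /(_ isT).
exists b; split; last by move=> i; case: (bP i).
split=> [i _|i j _ _ ij]; first by case: (bP i).
have [abi bin Ci mi] := bP i; have [abj bjn Cj mj] := bP j.
have nij : i != j by rewrite neq_ltn ij.
have mono := @card_lex_before_le n a; have mono1 := @card_lex_before_lt n a.
have mono2 := @card_lex_before_lt2 n a.
pose c x t := #|lex_before a x t|.
rewrite -!/(c _ _) in Ci Cj.
have {}mi x : a i < x < b i -> c (a i) i + (x - a i) < c x i by exact: mi.
have {}mj x : a j < x < b j -> c (a j) j + (x - a j) < c x j by exact: mj.
have {}mono x t y u : (x < y) || (x == y) && (t <= u) -> c x t <= c y u by exact: mono.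
have {}mono1 x t y u k : (x < y) || (x == y) && (t <= u) ->
    k \notin lex_before a x t -> k \in lex_before a y u -> c x t < c y u.
  exact: mono1.
have {}mono2 x t y u : (x < y) || (x == y) && (t <= u) ->
    i \notin lex_before a x t -> i \in lex_before a y u ->
    j \notin lex_before a x t -> j \in lex_before a y u -> (c x t).+1 < c y u.
  by move=> le; apply: mono2.
rewrite /hom_overlap /ext_overlap.
have [lt_a|lt_a|eq_a] := ltngtP (a i) (a j).
- (* If the later interval starts inside the earlier one, the walk of j begins
     above level h (a i, i), so it returns strictly before b i. *)
  suff : b i <= a j \/ b j < b i by lia.
  have [?|aj_bi] := leqP (b i) (a j); [by left | right].
  have := mi (a j); rewrite lt_a aj_bi => /(_ isT) hi.
  have h1 : c (a j) i <= c (a j) j.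
    by apply: mono; lia.
  have h2 : c (b i).-1 j <= c (b i) i.
    by apply: mono; lia.
  have [e|ne] := eqVneq (b i).-1 (a j).
    have : c (a j) j < c (b i) i.
      by apply: (mono1 _ _ _ _ j); rewrite ?inE; lia.
    lia.
  rewrite ltnNge; apply/negP => le_b.
  have := mj (b i).-1; lia.
- (* If the earlier interval starts inside the later one, the walk of i begins
     at least at height h (a j, j), to which the walk of j is back at
     b j, so it has returned by b j. *)
  suff : b j < a i \/ b i <= b j by lia.
  have [?|ai_bj] := ltnP (b j) (a i); [by left | right].
  (* If a i = b j, the index i itself would push the walk of j above its
     starting height at b j. *)
  move: ai_bj; rewrite leq_eqVlt => /orP[/eqP eq|lt].
    have h1 : c (b j).-1 j < c (b j) j.
      by apply: (mono1 _ _ _ _ i); rewrite ?inE; lia.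
    have [e|ne] := eqVneq (b j).-1 (a j).
      have : (c (a j) j).+1 < c (b j) j.
        by apply: mono2; rewrite ?inE; lia.
      lia.
    have := mj (b j).-1; lia.
  rewrite leqNgt; apply/negP => lt_b.
  have := mi (b j); rewrite lt lt_b => /(_ isT) hi.
  have h1 : c (b j) i <= c (b j) j.
    by apply: mono; lia.
  have h2 : c (a i).-1 j <= c (a i) i.
    by apply: mono; lia.
  have [e|ne] := eqVneq (a i).-1 (a j).
    have : c (a j) j < c (a i) i.
      by apply: (mono1 _ _ _ _ j); rewrite ?inE; lia.
    lia.
  have := mj (a i).-1; lia.
- (* For equal starting points the walk of j begins at least 1 above that of i. *)
  suff : b j < b i by lia.
  have h1 : c (a i) i < c (a j) j.
    by apply: (mono1 _ _ _ _ i); rewrite ?inE; lia.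
  have h2 : c (b i).-1 j <= c (b i) i.
    by apply: mono; lia.
  have [e|ne] := eqVneq (b i).-1 (a j).
    have : (c (a i) i).+1 < c (b i) i.
      by apply: mono2; rewrite ?inE; lia.
    lia.
  rewrite ltnNge; apply/negP => le_b.
  have := mj (b i).-1; lia.
Qed.

End Intervals.

(** * Representations of an arbitrary quiver *)

Section General.
Variables (k : fieldType) (Q : quiver).
Implicit Types U V W X : rep k Q.

Definition arrow_family V W := forall a : arrow Q, 'M[k]_(dimv V (src a), dimv W (tgt a)).

(** The cokernel of this boundary map is Ext^1(V, W): this is the standard
resolution of a representation of a quiver by projectives of length one. *)
Definition boundary_onto V W : Prop :=
  forall C : arrow_family V W, exists h : family V W,
    forall a, h (src a) *m repmx W a - repmx V a *m h (tgt a) = C a.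

Lemma factor_row_full m n p q (f : 'M[k]_(m, n)) (g : 'M[k]_(n, p)) (D : 'M[k]_(n, q)) :
  row_full g -> (f == kermx g)%MS -> f *m D = 0 -> exists C, D = g *m C.
Proof.
move=> /row_fullP[s sg] /andP[_ kf] fD; exists (s *m D).
have /submxP[t et] : (1%:M - g *m s <= f)%MS.
  apply: submx_trans kf; apply/sub_kermxP.
  by rewrite mulmxBl mul1mx -mulmxA sg mulmx1 subrr.
apply/eqP; rewrite -subr_eq0 mulmxA -{1}[D]mul1mx -mulmxBl et -mulmxA fD mulmx0.
by [].
Qed.

(** Retractions of W -> X chosen at each vertex fail to commute with the arrows by
maps vanishing on W, that is by an arrow family from V to W; a preimage of it
under the boundary corrects them to a morphism of representations. *)
Lemma boundary_onto_ext1_zero V W : boundary_onto V W -> ext1_zero V W.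
Proof.
move=> onto [X f g [fh gh ff gf ex]]; rewrite /ext_equiv /=.
have /fin_all_exists[r fr] i : exists r, f i *m r = 1%:M by exact/row_freeP.
have /fin_all_exists[C dC] (a : arrow Q) : exists C : 'M_(dimv V (src a), dimv W (tgt a)),
    repmx X a *m r (tgt a) - r (src a) *m repmx W a = g (src a) *m C.
  apply: factor_row_full (gf _) (ex _) _.
  by rewrite mulmxBr !mulmxA -fh -(mulmxA (repmx W a)) !fr mulmx1 mul1mx subrr.
have [h hC] := onto C.
pose r' i := r i + g i *m h i.
have gf0 i : f i *m g i = 0.
  by apply/sub_kermxP; case/andP: (ex i).
exists (fun i => row_mx (r' i) (g i)); split.
- move=> a; rewrite /dsum /= mul_row_block mul_mx_row !mulmx0 addr0 add0r gh.
  congr row_mx; move: (dC a); rewrite -hC mulmxBr !mulmxA => /eqP.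
  rewrite subr_eq => /eqP e; rewrite /r' mulmxDr mulmxDl mulmxA gh e.
  by rewrite addrAC subrK addrC.
- by move=> i; rewrite mul_mx_row mulmxDr mulmxA gf0 mul0mx addr0 fr.
- by move=> i; rewrite mul_row_col mulmx0 mulmx1 add0r.
Qed.

(** The extension of V by W with cocycle [C]. *)
Definition glued V W (C : arrow_family V W) : rep k Q :=
  Rep (dimv := fun i => (dimv W i + dimv V i)%N)
      (fun a => block_mx (repmx W a) 0 (C a) (repmx V a)).

Lemma glued_exact V W (C : arrow_family V W) :
  short_exact (V := V) (W := W) (X := glued C) (@split_inc _ _ V W) (@split_prj _ _ V W).
Proof.
have [_ _ ff gf ex] := @split_exact k Q V W; split=> // a.
  by rewrite /split_inc mul_mx_row mulmx1 mulmx0 mul_row_block !mul1mx !mul0mx !addr0.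
rewrite /split_prj /= [RHS]mul_col_mx mul0mx mul1mx.
by rewrite mul_block_col !mulmx0 !mulmx1 !add0r.
Qed.

(** A splitting of the extension glued along [C] is unipotent lower triangular, and
its lower left blocks have boundary [C]. *)
Lemma ext1_zero_boundary_onto V W : ext1_zero V W -> boundary_onto V W.
Proof.
move=> ez C; have [h [/= hh ih hp]] := ez (Extension (glued_exact C)).
exists (fun i => dlsubmx (h i)) => a.
have eh i : h i = block_mx 1%:M 0 (dlsubmx (h i)) 1%:M.
  have := ih i; have := hp i; rewrite -[h i]submxK /split_inc /split_prj.
  rewrite mul_row_block !mul1mx !mul0mx !addr0 => + /eq_row_mx[-> ->].
  rewrite mul_block_col !mulmx0 !mulmx1 !add0r => /eq_col_mx[_ ->].
  by rewrite block_mxKdl.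
have := hh a; rewrite (eh (src a)) (eh (tgt a)) /= !mulmx_block.
rewrite !mulmx1 !mul1mx !mulmx0 !mul0mx !addr0 !add0r => /eq_block_mx[_ _ e _].
by rewrite !block_mxKdl -e addrK.
Qed.

Lemma isomorphic_refl V : isomorphic V V.
Proof.
by exists (fun=> 1%:M), (fun=> 1%:M); split=> [v|v|v|v]; rewrite ?mulmx1 ?mul1mx.
Qed.

Lemma isomorphic_sym V W : isomorphic V W -> isomorphic W V.
Proof. by case=> f [g [fh gh fg gf]]; exists g, f. Qed.

Lemma hom_comp U V W (f : family U V) (g : family V W) :
  is_hom f -> is_hom g -> is_hom (fun i => f i *m g i).
Proof. by move=> fh gh a; rewrite mulmxA fh -!mulmxA gh. Qed.

Lemma isomorphic_trans U V W : isomorphic U V -> isomorphic V W -> isomorphic U W.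
Proof.
case=> f [f' [fh fh' ff' f'f]] [g [g' [gh gh' gg' g'g]]].
exists (fun i => f i *m g i), (fun i => g' i *m f' i); split; try exact: hom_comp.
  by move=> i; rewrite mulmxA -(mulmxA (f i)) gg' mulmx1.
by move=> i; rewrite mulmxA -(mulmxA (g' i)) f'f mulmx1.
Qed.

Lemma isomorphic_dimv V W : isomorphic V W -> dimv V =1 dimv W.
Proof.
case=> f [g [_ _ fg gf]] i; apply/eqP; rewrite eqn_leq.
by rewrite (mulmx1_min (fg i)) (mulmx1_min (gf i)).
Qed.

Lemma hom_zero_iso V V' W W' :
  isomorphic V V' -> isomorphic W W' -> hom_zero V W -> hom_zero V' W'.
Proof.
case=> f [f' [fh fh' ff' f'f]] [g [g' [gh gh' gg' g'g]]] hz u uh i.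
have := hz _ (hom_comp (hom_comp fh uh) gh') i => /(congr1 (fun A => f' i *m A *m g i)).
by rewrite mulmx0 mul0mx !mulmxA f'f mul1mx -mulmxA g'g mulmx1.
Qed.

Lemma boundary_onto_iso V V' W W' :
  isomorphic V V' -> isomorphic W W' -> boundary_onto V W -> boundary_onto V' W'.
Proof.
case=> f [f' [fh fh' ff' f'f]] [g [g' [gh gh' gg' g'g]]] onto C.
have [h hC] := onto (fun a => f (src a) *m C a *m g' (tgt a)).
exists (fun i => f' i *m h i *m g i) => a.
have := hC a => /(congr1 (fun A => f' (src a) *m A *m g (tgt a))).
rewrite !mulmxA f'f mul1mx -[C a *m _ *m _]mulmxA g'g mulmx1 => <-.
rewrite -[_ *m g _ *m _]mulmxA -gh !mulmxA fh'.
by rewrite mulmxBr mulmxBl !mulmxA.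
Qed.

Lemma ext1_zero_iso V V' W W' :
  isomorphic V V' -> isomorphic W W' -> ext1_zero V W -> ext1_zero V' W'.
Proof.
move=> iV iW /ext1_zero_boundary_onto onto.
exact/boundary_onto_ext1_zero/(boundary_onto_iso iV iW).
Qed.

Lemma short_exact_dimv W X V (f : family W X) (g : family X V) i :
  short_exact f g -> dimv X i = (dimv W i + dimv V i)%N.
Proof.
move=> [_ _ /(_ i) ff /(_ i) gf /(_ i) /eqmxP ex].
move: ff gf; rewrite /row_free /row_full => /eqP ff /eqP gf.
have := mxrank_ker (g i); rewrite -ex ff gf => e.
by rewrite e subnK // -gf rank_leq_row.
Qed.

(** The kernel of the projection [p] is a complement of M in V, and it is zero as V
is indecomposable. *)
Lemma split_off V M (u : family M V) (p : family V M) :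
  indecomposable V -> ~ is_zero M -> is_hom u -> is_hom p ->
  (forall i, u i *m p i = 1%:M) -> isomorphic V M.
Proof.
move=> [_ indec] nzM uh ph up.
pose K i := row_base (kermx (p i)).
pose W := Rep (dimv := fun i => \rank (kermx (p i)))
  (fun a : arrow Q => K (src a) *m repmx V a *m pinvmx (K (tgt a))).
have Kp i : K i *m p i = 0 by apply/sub_kermxP; rewrite eq_row_base.
have K_inv i m (A : 'M_(m, _)) : A *m p i = 0 -> A *m pinvmx (K i) *m K i = A.
  by move=> Ap; rewrite mulmxKpV // eq_row_base; apply/sub_kermxP.
have K_pinv i : K i *m pinvmx (K i) = 1%:M.
  have Kfree : row_free (K i) by rewrite row_base_free.
  by apply: (row_free_inj Kfree); rewrite mul1mx K_inv.
pose e i := 1%:M - p i *m u i.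
have ep i : e i *m p i = 0.
  by rewrite mulmxBl mul1mx -mulmxA up mulmx1 subrr.
have iso : isomorphic V (dsum M W).
  exists (fun i => row_mx (p i) (e i *m pinvmx (K i))).
  exists (fun i => col_mx (u i) (K i)); split.
  - move=> a; rewrite mul_mx_row /= mul_row_block !mulmx0 addr0 add0r ph.
    have eV : repmx V a *m e (tgt a) = e (src a) *m repmx V a.
      by rewrite mulmxBr mulmxBl mulmx1 mul1mx mulmxA ph -!mulmxA uh.
    congr row_mx; transitivity (e (src a) *m pinvmx (K (src a)) *m K (src a)
        *m repmx V a *m pinvmx (K (tgt a))); last by rewrite !mulmxA.
    by rewrite (K_inv _ _ _ (ep _)) -eV !mulmxA.
  - move=> a; rewrite [RHS]mul_col_mx /= mul_block_col !mul0mx addr0 add0r uh.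
    congr col_mx; rewrite /= K_inv // -mulmxA ph mulmxA Kp.
    by rewrite mul0mx.
  - by move=> i; rewrite mul_row_col K_inv // addrC subrK.
  - move=> i; have ue : u i *m e i = 0.
      by rewrite mulmxBr mulmx1 mulmxA up mul1mx subrr.
    have Ke : K i *m e i = K i by rewrite mulmxBr mulmx1 mulmxA Kp mul0mx subr0.
    rewrite mul_col_row up Kp (mulmxA (u i)) (mulmxA (K i)) ue Ke mul0mx K_pinv.
    by rewrite -scalar_mx_block.
case: (indec _ _ iso) => // W0.
exists p, u; split=> // i; apply/eqP; rewrite eq_sym -subr_eq0.
have ker0 : kermx (p i) = 0 by apply/eqP; rewrite -mxrank_eq0; apply/eqP/(W0 i).
by rewrite -submx0 -ker0; apply/sub_kermxP/ep.
Qed.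

End General.

(** * Interval representations of the linear quiver *)

Section IntervalModules.
Variables (k : fieldType) (n : nat).
Implicit Types (a b c d v : nat) (l g : nat -> k).
Local Notation rep := (rep k (linear_quiver n)).

Definition interval_rep a b : rep :=
  Rep (Q := linear_quiver n) (dimv := fun i : 'I_n => nat_of_bool (inside a b i))
    (fun _ => const_mx 1).

(** Every family between interval representations has this form, since its matrices
are empty or of size 1 x 1. *)
Definition scalar_family l (V W : rep) : family V W := fun i : 'I_n => const_mx (l i).

Lemma mulmx_const m p q (x y : k) :
  (const_mx x : 'M_(m, p)) *m const_mx y = const_mx ((x * y) *+ p) :> 'M_(m, q).
Proof.
apply/matrixP => i j; rewrite !mxE; under eq_bigr do rewrite !mxE.
by rewrite sumr_const card_ord.
Qed.

Lemma const_mx_bool (A C : bool) (x y : k) :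
  const_mx x = const_mx y :> 'M_(A, C) <-> (A -> C -> x = y).
Proof.
split=> [e hA hC|xy]; last first.
  by apply/matrixP => i j; rewrite !mxE; apply: xy;
    [case: (A) i => // -[] | case: (C) j => // -[]].
move: A C hA hC e => [] [] // _ _ e; by have := congr1 (fun M : 'M_(1, 1) => M ord0 ord0) e; rewrite !mxE.
Qed.

Lemma mx_bool_const (A C : bool) (M : 'M[k]_(A, C)) : exists x, M = const_mx x.
Proof.
case: A M => M; last by exists 0; rewrite flatmx0; apply/esym/flatmx0.
case: C M => M; last by exists 0; rewrite thinmx0; apply/esym/thinmx0.
by exists (M ord0 ord0); apply/matrixP => i j; rewrite mxE !ord1.
Qed.

Lemma fin_extend m (l : 'I_m -> k) : exists l', forall i : 'I_m, l' (val i) = l i.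
Proof.
by exists (fun v => if insub v is Some i then l i else 0) => i; rewrite valK.
Qed.

Lemma interval_family_scalar a b c d (f : family (interval_rep a b) (interval_rep c d)) :
  exists l, forall i, f i = scalar_family l _ _ i.
Proof.
have /fin_all_exists[l fl] (i : 'I_n) : exists x, f i = const_mx x.
  exact: mx_bool_const.
by have [l' ll'] := fin_extend l; exists l' => i; rewrite fl /scalar_family ll'.
Qed.

(** The arrow [v -> v.+1] carries a nonempty matrix from M[a, b) at [v] to M[c, d) at [v.+1]
only if both positions are in their intervals. *)
Definition arrow_scalars (P : nat -> Prop) a b c d : Prop :=
  forall v, inside a b v -> inside c d v.+1 -> P v.

Lemma arrow_scalarsP (P : nat -> Prop) a b c d : (d <= n)%N ->
  arrow_scalars P a b c d <->
  forall v : 'I_n.-1, inside a b v -> inside c d v.+1 -> P v.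
Proof.
move=> dn; split=> [H v|H v iv jv]; first exact: H.
have vn : (v < n.-1)%N by move: jv; rewrite /inside; lia.
exact: (H (Ordinal vn)).
Qed.

Lemma interval_homP l a b c d : (d <= n)%N ->
  is_hom (scalar_family l (interval_rep a b) (interval_rep c d)) <->
  arrow_scalars (fun v => l v.+1 *+ inside a b v.+1 = l v *+ inside c d v) a b c d.
Proof.
move=> dn; rewrite arrow_scalarsP //; split=> H v; have := H v.
  by rewrite /= !mulmx_const mul1r mulr1 => /const_mx_bool.
by move=> Hv; rewrite /= !mulmx_const mul1r mulr1; apply/const_mx_bool.
Qed.

(** A morphism is a scalar that is constant along the intersection of the two
intervals.  An arrow of the source entering the intersection from the left, or
one of the target leaving it to the right, forces this scalar to be 0. *)
Lemma interval_hom_zero a b c d : (d <= n)%N ->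
  hom_zero (interval_rep a b) (interval_rep c d) <-> ~~ hom_overlap a b c d.
Proof.
move=> dn; split=> [hz|nh f].
  apply/negP => /andP[/andP[ca ad] db].
  have an := leq_trans ad dn.
  have h1 : is_hom (scalar_family (fun=> 1) (interval_rep a b) (interval_rep c d)).
    apply/interval_homP => // v iv jv.
    have -> : inside a b v.+1 by move: iv jv; rewrite /inside; lia.
    by have -> : inside c d v by move: iv jv; rewrite /inside; lia.
  have : const_mx 1 = const_mx 0 :> 'M[k]_(inside a b a, inside c d a).
    exact: (hz _ h1 (Ordinal an)).
  move/const_mx_bool; rewrite /inside => /(_ _ _)/eqP; rewrite oner_eq0.
  by move=> e; have : false by apply: e; lia.
have [l fl] := interval_family_scalar f; move=> fh i; rewrite fl.
have {fh} : is_hom (scalar_family l (interval_rep a b) (interval_rep c d)).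
  by move=> v; rewrite -!fl; apply: fh.
move/interval_homP => /(_ dn) H.
suff z v : inside a b v -> inside c d v -> l v = 0.
  by apply/const_mx_bool; apply: z.
have [lt_ac|le_ca] := ltnP a c.
  elim: v => [|v IH] iv jv; first by move: jv; rewrite /inside; lia.
  have := H v; rewrite iv mulr1n jv => -> //; last by move: iv jv; rewrite /inside; lia.
  case: (boolP (inside c d v)) => // jv'.
  by apply: IH => //; move: iv jv jv'; rewrite /inside; lia.
have lt_bd : inside a b v -> inside c d v -> (b < d)%N.
  by move: nh; rewrite /hom_overlap /inside; lia.
move=> iv jv; have {}lt_bd := lt_bd iv jv.
have [m em] := ubnP (b - v); elim: m v em iv jv => // m IH v em iv jv.
have := H v iv; rewrite jv mulr1n => <- //; last by move: iv jv; rewrite /inside; lia.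
case: (boolP (inside a b v.+1)) => // iv'.
by apply: IH => //; move: iv jv iv'; rewrite /inside; lia.
Qed.

Lemma interval_boundaryP a b c d : (d <= n)%N ->
  boundary_onto (interval_rep a b) (interval_rep c d) <->
  forall g, exists l, arrow_scalars
    (fun v => l v *+ inside c d v - l v.+1 *+ inside a b v.+1 = g v) a b c d.
Proof.
move=> dn; split=> [onto g|onto C].
  have [h hC] := onto (fun v : 'I_n.-1 => const_mx (g v)).
  have [l hl] := interval_family_scalar h; exists l; apply/arrow_scalarsP => // v.
  have := hC v; rewrite !hl /scalar_family /= !mulmx_const mul1r mulr1 => e.
  by apply/const_mx_bool; rewrite -e; apply/matrixP => i j; rewrite !mxE.
have /fin_all_exists[g0 Cg] (v : 'I_n.-1) : exists x, C v = const_mx x.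
  exact: mx_bool_const.
have [g eg] := fin_extend g0; have [l hl] := onto g.
exists (scalar_family l (interval_rep a b) (interval_rep c d)) => v.
rewrite Cg -eg /scalar_family /= !mulmx_const mul1r mulr1.
have /const_mx_bool <- : inside a b v -> inside c d v.+1 -> _ := hl v.
by apply/matrixP => i j; rewrite !mxE.
Qed.

(** The boundary equation is a first-order recurrence along the relevant arrows.
It is overdetermined, with a compatibility condition on the sum of its right
hand sides, exactly when [a < c <= b < d]; otherwise it can be solved from the
right (if [c <= a]) or from the left. *)
Lemma interval_ext1_zero a b c d : (d <= n)%N ->
  ext1_zero (interval_rep a b) (interval_rep c d) <-> ~~ ext_overlap a b c d.
Proof.
move=> dn; split=> [/ext1_zero_boundary_onto|ne]; last apply: boundary_onto_ext1_zero.
  move/(interval_boundaryP _ _ _ dn) => onto; apply/negP => /andP[/andP[ac cb] bd].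
  (* A right hand side of sum 1, supported on the first relevant arrow. *)
  have [l hl] := onto (fun v => (v.+1 == c)%:R).
  suff z v : (c <= v <= b)%N -> l v *+ inside a b v = -1.
    have := z b; rewrite cb leqnn /inside ltnn andbF mulr0n => /(_ isT)/eqP.
    by rewrite eq_sym oppr_eq0 oner_eq0.
  elim: v => [|v IH] hv; first by lia.
  have iv : inside a b v by rewrite /inside; lia.
  have jv : inside c d v.+1 by rewrite /inside; lia.
  have := hl v iv jv; have [ev|nv] := eqVneq v.+1 c.
    rewrite (_ : inside c d v = false); last by rewrite /inside; lia.
    by rewrite mulr0n sub0r => /eqP; rewrite eqr_oppLR => /eqP.
  move/eqP; rewrite subr_eq0 => /eqP <-; rewrite -IH; last by lia.
  by congr (_ *+ nat_of_bool _); rewrite /inside; lia.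
apply/interval_boundaryP => // g; have [le_ca|lt_ac] := leqP c a.
  exists (fun v => \sum_(v <= u < b) g u) => v iv jv.
  rewrite (_ : inside c d v); last by move: iv jv; rewrite /inside; lia.
  rewrite mulr1n big_ltn; last by case/andP: iv.
  case: (boolP (inside a b v.+1)) => iv'; first by rewrite mulr1n addrK.
  by rewrite big_geq ?addr0 ?mulr0n ?subr0 //; move: iv iv'; rewrite /inside; lia.
pose l := fix l v := if v is u.+1 then l u *+ inside c d u - g u else 0.
exists l => v iv jv /=.
rewrite (_ : inside a b v.+1); first by rewrite mulr1n opprB addrC subrK.
by move: ne iv jv; rewrite /ext_overlap /inside; lia.
Qed.

(** Endomorphisms are scalar, hence so is the projection onto the first summand of
any decomposition. *)
Lemma interval_indecomposable a b : (a < b <= n)%N -> indecomposable (interval_rep a b).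
Proof.
move=> /andP[ab bn]; have an := leq_trans ab bn; split=> [z|V1 V2].
  by have := z (Ordinal an); rewrite /= /inside leqnn ab.
case=> f [g [fh gh fg gf]].
pose p : family (dsum V1 V2) (dsum V1 V2) := fun i => block_mx 1%:M 0 0 0.
have ph : is_hom p.
  by move=> v; rewrite /p /= !mulmx_block !mulmx1 !mul1mx !mulmx0 !mul0mx !addr0.
have eh : is_hom (fun i => f i *m p i *m g i).
  exact: hom_comp (hom_comp fh ph) gh.
have [l el] := interval_family_scalar (fun i => f i *m p i *m g i).
have l_const v : inside a b v -> l v = l a.
  have {eh} : is_hom (scalar_family l (interval_rep a b) (interval_rep a b)).
    by move=> v'; rewrite -!el; apply: eh.
  move/interval_homP => /(_ bn) H.
  elim: v => [|v IH] iv; first by congr l; move: iv; rewrite /inside; lia.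
  have [->//|ne] := eqVneq v.+1 a.
  have iv' : inside a b v by move: iv ne; rewrite /inside; lia.
  by have := H v iv' iv; rewrite iv iv' IH.
have pl i : p i = (l a)%:M.
  have -> : p i = g i *m (f i *m p i *m g i) *m f i.
    by rewrite !mulmxA gf mul1mx -mulmxA gf mulmx1.
  have := el i => /= ->.
  have -> : scalar_family l (interval_rep a b) (interval_rep a b) i = (l a)%:M.
    apply/matrixP => s t; rewrite !mxE.
    move: s t => /=; case: (boolP (inside a b (i : 'I_n))) => [iv s t|_ []//].
    by rewrite l_const // !ord1 eqxx.
  by rewrite mul_mx_scalar -scalemxAl gf scalemx1.
have scalar0 m (x : k) : x%:M = 0 :> 'M_m -> x != 0 -> m = 0%N.
  case: m => // m /(congr1 (fun M : 'M_m.+1 => M ord0 ord0)).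
  by rewrite !mxE eqxx mulr1n => -> /eqP.
have blocks i : 1%:M = (l a)%:M :> 'M_(dimv V1 i) /\ 0 = (l a)%:M :> 'M_(dimv V2 i).
  by have := pl i; rewrite /p scalar_mx_block => /eq_block_mx[].
have [la0|la_nz] := eqVneq (l a) 0; [left|right] => i; have [e1 e2] := blocks i.
  by apply: (scalar0 _ 1) (oner_neq0 _); rewrite e1 la0; apply: raddf0.
exact: scalar0 (esym e2) la_nz.
Qed.

End IntervalModules.

(** * Indecomposables of the linear quiver *)

Section Classification.
Variables (k : fieldType) (n : nat).
Variable V : rep k (linear_quiver n).
Local Notation arr := (arrow (linear_quiver n)).

Lemma eq_mx_bool_rows (A : bool) m (N N' : 'M[k]_(A, m)) : (A -> N = N') -> N = N'.
Proof. by case: A N N' => [N N' ->|N N' _] //; rewrite flatmx0; apply/esym/flatmx0. Qed.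

Lemma eq_mx_bool_cols (A : bool) m (N N' : 'M[k]_(m, A)) : (A -> N = N') -> N = N'.
Proof. by case: A N N' => [N N' ->|N N' _] //; rewrite thinmx0; apply/esym/thinmx0. Qed.

Lemma linear_quiver_tgt_eq (e e' : arr) : tgt e = tgt e' -> e = e'.
Proof. by move=> /(congr1 val)[] ?; apply: val_inj. Qed.

Lemma linear_quiver_tgtP (b : 'I_n) : (0 < b)%N -> exists e : arr, tgt e = b.
Proof.
move=> b0; have bn : (b.-1 < n.-1)%N by have := ltn_ord b; lia.
by exists (Ordinal bn); apply: val_inj; rewrite /= prednK.
Qed.

(** A morphism from V to an interval representation ending at [b] is determined in
this way by its covector at [b]. *)
Lemma pulled_back_covectors (b : 'I_n) (w : 'cV_(dimv V b)) :
  exists phi : forall i : 'I_n, 'cV[k]_(dimv V i), phi b = w /\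
    forall e : arr, (val (tgt e) <= b)%N -> phi (src e) = repmx V e *m phi (tgt e).
Proof.
have [m em] := ubnP (val b); elim: m b em w => // m IH b em w.
have [b0|b0] := posnP (val b).
  exists (dfwith (fun i : 'I_n => 0 : 'cV[k]_(dimv V i)) w); split; first by rewrite dfwith_in.
  by move=> e; rewrite b0.
have [e0 eb] := linear_quiver_tgtP b0; move: em w b0; rewrite -{b}eb => em w b0.
have [phi [phib phiE]] := IH (src e0) em (repmx V e0 *m w).
exists (dfwith phi w); split; first by rewrite dfwith_in.
move=> e; rewrite leq_eqVlt => /orP[/eqP/val_inj/linear_quiver_tgt_eq ->|lt].
  by rewrite dfwith_in dfwith_out // -val_eqE /= gtn_eqF.
rewrite !dfwith_out ?phiE // -val_eqE neq_ltn.
  by rewrite lt orbT.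
by rewrite (leq_ltn_trans _ lt) ?orbT.
Qed.

(** The last vertex [b] is a natural number so that a longest chain can be found as
a maximum over nat; [x] is unconstrained away from the vertices a, ..., b. *)
Definition vector_chain (a b : nat) (x : forall i : 'I_n, 'rV[k]_(dimv V i)) : Prop :=
  (forall e : arr, (a <= val (src e))%N -> (val (tgt e) <= b)%N ->
     x (tgt e) = x (src e) *m repmx V e) /\
  exists2 i : 'I_n, val i = b & x i != 0.

Lemma maximal_chain : ~ is_zero V ->
  exists a (b : 'I_n) x, [/\ (a <= b)%N,
    forall i : 'I_n, (i < a)%N -> dimv V i = 0%N,
    vector_chain a b x
  & forall e : arr, src e = b -> x (src e) *m repmx V e = 0].
Proof.
move=> /existsNP[i0 /eqP nz0].
case: (arg_minnP (fun i : 'I_n => val i) (P := fun i => dimv V i != 0%N) nz0).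
move=> a nza mina.
have zero_before (i : 'I_n) : (i < a)%N -> dimv V i = 0%N.
  by move=> ia; apply/eqP; apply: contraTT ia => /mina; rewrite -leqNgt.
pose P b := `[< exists x, vector_chain a b x >] && (a <= b)%N.
have Pa : exists b, P b.
  exists a; rewrite /P leqnn andbT; apply/asboolP.
  have [w w0] : exists w : 'rV[k]_(dimv V a), w != 0.
    exists (const_mx 1); apply/eqP => /rowP; case: (dimv V a) nza => // d _.
    by move=> /(_ ord0)/eqP; rewrite !mxE oner_eq0.
  exists (dfwith (fun i : 'I_n => 0 : 'rV[k]_(dimv V i)) w); split; last first.
    by exists a => //; rewrite dfwith_in.
  by move=> e /=; lia.
have Pn b : P b -> (b <= n)%N.
  by case/andP=> /asboolP[x [_ [i <- _]]] _; exact: ltnW (ltn_ord i).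
case: (ex_maxnP Pa Pn) => b /andP[/asboolP[x cx] ab] maxb.
have [xE [b' eb xb]] := cx; rewrite -{b}eb in ab maxb cx xE *.
exists a, b', x; split=> // e eb; apply/eqP; apply: contraT => nz.
have tb : val (tgt e) = b'.+1 by rewrite -eb.
have : P b'.+1.
  rewrite /P (leq_trans ab) // andbT; apply/asboolP.
  exists (dfwith x (x (src e) *m repmx V e)); split; last first.
    by exists (tgt e); rewrite ?dfwith_in.
  move=> e' ae e'b; have [ee'|ne] := eqVneq e' e.
    by rewrite ee' dfwith_in dfwith_out // -val_eqE /= gtn_eqF.
  have ne' : val (tgt e') != val (tgt e).
    by apply: contra_neq ne => /val_inj/linear_quiver_tgt_eq.
  have te : val (tgt e') = (val (src e')).+1 by [].
  have lt : (val (tgt e') <= b')%N by rewrite -ltnS ltn_neqAle -{1}tb ne'.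
  rewrite !dfwith_out ?xE // -val_eqE tb eq_sym ltn_eqF //.
by move/maxb; rewrite ltnn.
Qed.

(** Take a vector at the first nonzero vertex [a] that survives as far as possible,
up to [b].  It generates a subrepresentation M[a, b + 1).  A covector equal to 1
on its image at [b], pulled back to all the earlier vertices, is a projection
onto it: no condition arises before [a], where V is zero.  So this interval
representation splits off. *)
Lemma indecomposable_interval : indecomposable V ->
  exists a b, (a < b <= n)%N /\ isomorphic V (interval_rep k n a b).
Proof.
move=> iV; have [nzV _] := iV.
have [a [b [x [ab zero_before [xE [b' /val_inj-> xb]] x_end]]]] := maximal_chain nzV.
have [w xw] : exists w : 'cV[k]_(dimv V b), x b *m w = 1%:M.
  by apply/row_freeP; rewrite /row_free rank_rV xb.
have [phi [phib phiE]] := pulled_back_covectors w.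
exists a, b.+1; split; first by rewrite ltnS ab ltn_ord.
pose M := interval_rep k n a b.+1.
pose u : family M V := fun i : 'I_n => (const_mx 1 : 'M_(inside a b.+1 i, 1)) *m x i.
pose p : family V M := fun i : 'I_n => phi i *m (const_mx 1 : 'M_(1, inside a b.+1 i)).
have x_phi (i : 'I_n) : inside a b.+1 i -> x i *m phi i = 1%:M.
  have [m em] := ubnP (b - i); elim: m i em => // m IH i em /andP[ai].
  rewrite ltnS leq_eqVlt => /orP[/eqP/val_inj ->|ib]; first by rewrite phib.
  have [e ei] : exists e : arr, src e = i.
    have lt : (i < n.-1)%N by have := ltn_ord b; lia.
    by exists (Ordinal lt); apply: val_inj.
  rewrite -{i}ei in em ai ib *.
  rewrite phiE // mulmxA -xE //; apply: IH; first by move: em ib => /=; lia.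
  by rewrite /inside /= ltnS ib (leq_trans ai).
apply: (@split_off _ _ V M u p) => //.
- by move=> /(_ b); rewrite /M /= /inside ab ltnSn.
- move=> e; apply: eq_mx_bool_rows => /andP[ae eb].
  rewrite /u /= mulmxA mulmx_const mul1r -mulmxA.
  have [lt|ge] := ltnP (val (src e)) b.
    have -> : inside a b.+1 (val (tgt e)) by rewrite /inside /= ltnS lt leqW.
    by rewrite mulr1n xE.
  have eqb : src e = b by apply/val_inj/eqP; rewrite eqn_leq -ltnS eb.
  have -> : inside a b.+1 (val (tgt e)) = false by rewrite /inside /= ltnS ltnNge ge andbF.
  rewrite mulr0n x_end // mulmx0; apply/matrixP => s t.
  by rewrite !mxE big1 // => r _; rewrite mxE mul0r.
- move=> e; apply: eq_mx_bool_cols => /andP[ae eb].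
  rewrite /p /= mulmxA -[RHS]mulmxA mulmx_const mul1r.
  have [le|lt] := leqP a (val (src e)).
    have -> : inside a b.+1 (val (src e)) by rewrite /inside le (leq_trans _ eb).
    by rewrite mulr1n phiE.
  have V0 := zero_before _ lt; apply/matrixP => s; exfalso.
  by move: s; rewrite V0 => -[].
- move=> i; rewrite /u /p mulmxA; apply: eq_mx_bool_rows => iI.
  rewrite -(mulmxA _ (x i)) x_phi // mulmx1 mulmx_const mul1r mulr1n.
  apply/matrixP => s t; rewrite !mxE; move: s t; rewrite /= iI => s t.
  by rewrite !ord1 eqxx.
Qed.

End Classification.

(** * The filtration of the Grothendieck group *)

Section K0Dimension.
Variables (k : fieldType) (Q : quiver).

Definition freeg_dim (i : vertex Q) (x : {freeg (rep k Q) / int}) : int^o :=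
  fglift (fun V : rep k Q => (dimv V i)%:Z : int^o) x.

Lemma freeg_dimB i : {morph freeg_dim i : x y / x - y}.
Proof. exact: lift_is_additive. Qed.

Lemma freeg_dim1 i V : freeg_dim i [freeg [:: (1, V)]] = (dimv V i)%:Z.
Proof. by rewrite /freeg_dim liftU scale1r. Qed.

Lemma freeg_dim_ker_zmod_closed i : zmod_closed (fun x => freeg_dim i x == 0).
Proof.
split=> [|x y /eqP x0 /eqP y0]; apply/eqP.
  by rewrite -(subrr 0) freeg_dimB subrr.
by rewrite freeg_dimB x0 y0 subrr.
Qed.

Definition freeg_dim_ker i : zmodClosed {freeg (rep k Q) / int} :=
  HB.pack (fun x => freeg_dim i x == 0)
    (GRing.isZmodClosed.Build _ _ (freeg_dim_ker_zmod_closed i)).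

(** Dimension vectors are additive on short exact sequences. *)
Lemma freeg_dim_relations i x : x \in K0_relations (k := k) (Q := Q) -> freeg_dim i x = 0.
Proof.
move=> /asboolP rel; apply/eqP; apply: (rel (freeg_dim_ker i)) => W X V f g ex.
apply/eqP; rewrite !freeg_dimB !freeg_dim1 (short_exact_dimv i ex).
by rewrite PoszD addrAC addrK subrr.
Qed.

Definition K0_dim (i : vertex Q) (x : K0 k Q) : int := freeg_dim i (repr x).

Lemma K0_dim_pi i x : K0_dim i (\pi_(Quotient.quot (K0_subgroup k Q))%qT x) = freeg_dim i x.
Proof.
apply/eqP; rewrite -subr_eq0 -freeg_dimB; apply/eqP/freeg_dim_relations.
have : (repr (\pi_(Quotient.quot (K0_subgroup k Q))%qT x) - x) \in K0_subgroup k Q.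
  by rewrite Quotient.idealrBE reprK.
by [].
Qed.

Lemma K0_dim_class i V : K0_dim i (K0_class V) = (dimv V i)%:Z.
Proof. by rewrite K0_dim_pi freeg_dim1. Qed.

Lemma K0_dimB i : {morph K0_dim i : x y / x - y}.
Proof.
move=> x y; rewrite -{1}[x]reprK -{1}[y]reprK -raddfB K0_dim_pi.
exact: freeg_dimB.
Qed.

End K0Dimension.

Section SupportFiltration.
Variables (k : fieldType) (n : nat).
Local Notation K0n := (K0 k (linear_quiver n)).

Definition vanishing_below (m : nat) : pred K0n :=
  fun x => [forall i : 'I_n, (i.+1 < m)%N ==> (K0_dim (i : vertex (linear_quiver n)) x == 0)].

Lemma vanishing_below_zmod_closed m : zmod_closed (vanishing_below m).
Proof.
split=> [|x y].
  apply/forallP => i; apply/implyP => _; by rewrite -(subrr 0) K0_dimB subrr.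
move=> /forallP x0 /forallP y0; apply/forallP => i; apply/implyP => im.
by rewrite K0_dimB (eqP (implyP (x0 i) im)) (eqP (implyP (y0 i) im)) subrr.
Qed.

Definition support_filtration (m : nat) : zmodClosed K0n :=
  HB.pack (vanishing_below m)
    (GRing.isZmodClosed.Build _ _ (vanishing_below_zmod_closed m)).

Lemma support_filtrationP : filtration n support_filtration.
Proof.
split=> [x|m _ x] /=; first by apply/forallP => i; rewrite ltnS ltn0.
move=> /forallP x0; apply/forallP => i; apply/implyP => im.
by apply: (implyP (x0 i)); apply: ltnW.
Qed.

(** M[a, b) vanishes at the first [a] vertices and not at the next one. *)
Lemma support_filtration_level a b V :
  (a < b <= n)%N -> isomorphic V (interval_rep k n a b) ->
  filtration_level n support_filtration (K0_class V) = a.+1.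
Proof.
move=> /andP[ab bn] /isomorphic_dimv dV.
have mem m : (K0_class V \in support_filtration m) = (m <= a.+1)%N.
  apply/forallP/idP => [x0|le i].
    rewrite leqNgt; apply/negP => lt.
    have := implyP (x0 (Ordinal (leq_trans ab bn))) lt.
    by rewrite K0_dim_class dV /= /inside leqnn ab.
  apply/implyP => im; rewrite K0_dim_class dV /= /inside.
  by rewrite (_ : (a <= i)%N = false) //; lia.
have an1 : (a.+1 < n.+1)%N by rewrite ltnS (leq_trans ab bn).
rewrite /filtration_level; under eq_bigl do rewrite mem.
apply/eqP; rewrite eqn_leq; apply/andP; split.
  by apply/bigmax_leqP_seq.
by rewrite (leq_bigmax_seq (F := id)) // mem_index_iota an1.
Qed.

End SupportFiltration.

(** * Exceptional sequences and parking functions *)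

Theorem theorem5p9 (k : closedFieldType) (n : nat) (hn : (0 < n)%N) :
  exists F : nat -> zmodClosed (K0 k (linear_quiver n)),
    [/\ filtration n F,
        (forall E : 'I_n -> rep k (linear_quiver n),
           exceptional_sequence E -> parking_function (levels F E)),
        (forall E E' : 'I_n -> rep k (linear_quiver n),
           exceptional_sequence E -> exceptional_sequence E' ->
           (levels F E = levels F E' <-> forall i, isomorphic (E i) (E' i)))
      & (forall f : {ffun 'I_n -> nat}, parking_function f ->
           exists E : 'I_n -> rep k (linear_quiver n),
             exceptional_sequence E /\ levels F E = f)].
Proof.
exists (support_filtration k n).
have interval_of (V : rep k (linear_quiver n)) : exceptional V ->
    exists ab : nat * nat, (ab.1 < ab.2 <= n)%N /\ isomorphic V (interval_rep k n ab.1 ab.2).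
  by case=> /indecomposable_interval[a [b abV]] _; exists (a, b).
have data E : exceptional_sequence E -> exists a b : 'I_n -> nat,
    [/\ forall i, isomorphic (E i) (interval_rep k n (a i) (b i)),
        forall i, levels (support_filtration k n) E i = (a i).+1
      & complete_intervals a b].
  case=> exc pairs; have /fin_all_exists[ab abP] i := interval_of _ (exc i).
  exists (fun i => (ab i).1), (fun i => (ab i).2); split.
  - by move=> i; case: (abP i).
  - by move=> i; rewrite ffunE; case: (abP i); apply: support_filtration_level.
  - split; last by move=> i; case: (abP i) => /andP[].
    split=> [i _|i j _ _ ij]; first by case: (abP i) => /andP[].
    have [/andP[_ bi] isoi] := abP i; have [_ isoj] := abP j.
    have [hz ez] := pairs _ _ ij; split.
      by apply/(interval_hom_zero k _ _ _ bi)/(hom_zero_iso isoj isoi).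
    by apply/(interval_ext1_zero k _ _ _ bi)/(ext1_zero_iso isoj isoi).
split; first exact: support_filtrationP.
- move=> E /data[a [b [_ lev cab]]]; split=> [i|m /andP[_ mn]].
    by have [[ab _] bn] := cab; rewrite lev /= (leq_trans (ab i _)) ?inE.
  rewrite (leq_trans (complete_parking cab mn)) //; apply/eq_leq/eq_card => i.
  by rewrite !inE lev.
- move=> E E' exE exE'; split=> [eq_lev i|iso].
    have [a [b [isoE levE cab]]] := data _ exE.
    have [a' [b' [isoE' levE' cab']]] := data _ exE'.
    have eqa : a = a'.
      by apply/funext => j; apply: succn_inj; rewrite -levE -levE' eq_lev.
    subst a'; apply: isomorphic_trans (isoE i) _.
    by rewrite (complete_intervals_inj cab cab'); apply/isomorphic_sym/isoE'.
  have [a [b [isoE levE cab]]] := data _ exE.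
  have [[ab _] bn] := cab.
  apply/ffunP => i; rewrite levE ffunE.
  rewrite (@support_filtration_level _ _ (a i) (b i)) ?ab ?inE ?bn //.
  exact: isomorphic_trans (isomorphic_sym (iso i)) (isoE i).
- move=> f [f_range f_park].
  have [b cab] : exists b, complete_intervals (fun i => (f i).-1) b.
    apply: parking_complete => [i|m mn].
      by case/andP: (f_range i); case: (f i).
    case: (posnP m) => [->//|m0]; have := f_park m; rewrite m0 mn => /(_ isT).
    move=> /leq_trans; apply; apply/eq_leq/eq_card => i.
    by rewrite !inE; case/andP: (f_range i); case: (f i).
  have [[ab ex] bn] := cab; rewrite /= in ab ex.
  have abn i : ((f i).-1 < b i <= n)%N by rewrite ab ?inE ?bn.
  exists (fun i => interval_rep k n (f i).-1 (b i)); split.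
    split=> [i|i j ij]; first split; first exact: interval_indecomposable.
      by apply/interval_ext1_zero => //; rewrite /ext_overlap ltnn.
    have [nh ne] := ex i j (in_setT _) (in_setT _) ij.
    by split; [apply/interval_hom_zero | apply/interval_ext1_zero].
  apply/ffunP => i; rewrite ffunE.
  rewrite (support_filtration_level (abn i)) ?prednK //; first by case/andP: (f_range i).
  exact: isomorphic_refl.
Qed.
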